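(* There exists an absolute constant $C$ such that for every weight $w$ on $[0,1)$ $$\|S_{w^{-1}}: L^2(w^{-1})\to L^{2,\infty}(w)\|=\|S: L^2(w)\to L^{2,\infty}(w)\|\ \le\ C\,\|M^d\|_{w^{-1}}.$$
   Context: Everything lives on $I_0=[0,1)$; $\mathcal D$ is the family of dyadic subintervals of $I_0$ (including $I_0$), $\langle f\rangle_J=\frac1{|J|}\int_J f\,dx$. A weight is an a.e. positive function $w$ on $I_0$ with $w,w^{-1}$ integrable; $w$ is identified with the measure $w\,dx$. $M^d f(x)=\sup_{J\in\mathcal D, J\ni x}\langle|f|\rangle_J$ is the dyadic maximal operator, and $\|M^d\|_{w^{-1}}$ denotes its norm $L^2(w^{-1})\to L^2(w^{-1})$ (possibly $+\infty$). $h_I$ is the $L^2(dx)$-normalized Haar function of $I\in\mathcal D$, and $Sf(x)=\big(\sum_{I\in\mathcal D}(f,h_I)^2\frac{\chi_I(x)}{|I|}\big)^{1/2}$ is the dyadic square function, where $(f,h_I)=\int f h_I\,dx$. For a weight $v$, $S_v f:=S(vf)$. $L^{2,\infty}(w)$ is the weak space with $\|f\|_{L^{2,\infty}(w)}=\sup_{\alpha>0}\alpha\,(w\{|f|>\alpha\})^{1/2}$; the norm of a sublinear operator is the best constant in the corresponding inequality. *)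

(* Defs.v *)
From HB Require Import structures.
From mathcomp Require Import all_boot all_order all_algebra.
From mathcomp Require Import all_classical all_reals all_analysis.

Set Implicit Arguments.
Unset Strict Implicit.
Unset Printing Implicit Defensive.

Import Order.TTheory GRing.Theory Num.Theory.
Import numFieldNormedType.Exports.

Local Open Scope classical_set_scope.
Local Open Scope ring_scope.

Section dyadic_square_function.
Context {R : realType}.
Implicit Types (f v w : R -> R) (g : R -> \bar R).

Local Notation mu := (@lebesgue_measure R).

Definition I0 : set R := `[0, 1[.

(* The family D consists of the intervals [dyadic n k] with [k < 2 ^ n]
   (so [dyadic 0 0] is I0); distinct pairs [(n, k)] give distinct intervals, and
   the halves of [dyadic n k] are [dyadic n.+1 (2 k)] and
   [dyadic n.+1 (2 k + 1)]. *)
Definition dyadic (n k : nat) : set R := `[k%:R / 2 ^+ n, k.+1%:R / 2 ^+ n[.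

Definition dyadic_length (n : nat) : R := (2 ^+ n)^-1.

Definition average f (n k : nat) : \bar R :=
  ((dyadic_length n)^-1%:E * \int[mu]_(x in dyadic n k) (f x)%:E)%E.

Definition dyadic_maximal f : R -> \bar R := fun x =>
  ereal_sup [set a | exists n k : nat,
    [/\ (k < 2 ^ n)%N, dyadic n k x & a = average (fun y => `|f y|) n k]].

Definition haar (n k : nat) : R -> R := fun x =>
  (Num.sqrt (dyadic_length n))^-1 *
  (\1_(dyadic n.+1 (2 * k).+1) x - \1_(dyadic n.+1 (2 * k)) x).

Definition haar_coef f (n k : nat) : R :=
  Rintegral mu I0 (fun x => f x * haar n k x).

Definition square_fun f : R -> \bar R := fun x =>
  sqrte (\sum_(0 <= n <oo) \sum_(k < 2 ^ n)
    (haar_coef f n k ^+ 2 * \1_(dyadic n k) x / dyadic_length n)%:E)%E.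

Definition square_fun_weight v f : R -> \bar R :=
  square_fun (fun x => v x * f x).

Definition weight w : Prop :=
  [/\ {ae mu, forall x, I0 x -> 0 < w x},
      mu.-integrable I0 (EFin \o w) &
      mu.-integrable I0 (EFin \o (fun x => (w x)^-1))].

Definition weight_measure v (A : set R) : \bar R :=
  (\int[mu]_(x in A) (v x)%:E)%E.

Definition L2norm v g : \bar R :=
  sqrte (\int[mu]_(x in I0) (g x ^+ 2 * (v x)%:E))%E.

Definition L2 v f : Prop :=
  measurable_fun I0 f /\ (L2norm v (EFin \o f) < +oo)%E.

Definition weakL2norm v g : \bar R :=
  ereal_sup [set (a%:E * sqrte (weight_measure v
                    [set x | I0 x /\ (a%:E < `|g x|)%E]))%E | a in `]0, +oo[].

(* Best constant of [T] from [L2 v] to the space with norm [N]; it is +oo when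
   no finite constant is admissible (infimum of the empty set). *)
Definition opnorm v (N : (R -> \bar R) -> \bar R)
    (T : (R -> R) -> R -> \bar R) : \bar R :=
  ereal_inf [set K%:E | K in [set K : R | 0 <= K /\
    forall f, L2 v f -> (N (T f) <= K%:E * L2norm v (EFin \o f))%E]].

End dyadic_square_function.

(* Main.v *)
Require Import Defs.
From HB Require Import structures.
From mathcomp Require Import all_boot all_order all_algebra.
From mathcomp Require Import all_classical all_reals all_analysis.
From mathcomp Require Import measurable_realfun.
From mathcomp Require Import ring lra zify.
Import Order.TTheory GRing.Theory Num.Theory.
Import numFieldNormedType.Exports.
Local Open Scope classical_set_scope.
Local Open Scope ring_scope.

Set Implicit Arguments.
Unset Strict Implicit.
Unset Printing Implicit Defensive.

(** The key is the weak-type inequality of Fefferman-Stein form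
      [lam * v {S f > lam} <= 3 * \int |f| (M^d v)]
    for every nonnegative integrable [v].  Applied to [v = w 1_E] with
    [E = {S f > lam}], followed by the weighted AM-GM inequality
      [|f| M <= (t f^2 w + M^2 w^-1 / t) / 2]
    and the bound of [M^d] on [L^2(w^-1)], where [v] has norm [w(E)^(1/2)], it
    gives [lam^2 w(E) <= 9 K^2 \int f^2 w] after optimizing in [t].
    The weak-type inequality is proved for the square function truncated at a
    finite level, by induction on the dyadic tree; the truncation is then
    removed by monotone convergence.
    The equality of the two norms is the substitution of [w g] for [f]. *)

(** * The weak-type inequality on a dyadic tree *)

Section tree.
Context {R : realFieldType}.
(* [F n k], [A n k], [V n k] stand for the integrals of [f], [|f|], [v] over the
   interval [dyadic n k], whose children are [(n+1, 2k)] and [(n+1, 2k+1)].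
   [level_mass j] is the [v]-mass of the set where [s] plus the squared jumps of
   the next [j] levels exceeds [lam ^ 2]; [maximal_mass j] is the integral of
   [|f|] against the maximal average of [v] over these levels, or [m] if larger. *)
Variables (F A V : nat -> nat -> R) (lam : R).

(** This is [(f, h_I)^2 / |I|] for [I = dyadic n k]: the Haar normalization contributes one factor
    [2 ^ n] and the division by [|I|] another. *)
Definition haar_jump (n k : nat) : R :=
  (2 ^+ n * (F n.+1 (2 * k).+1 - F n.+1 (2 * k)%N)) ^+ 2.

Fixpoint level_mass (j n k : nat) (s : R) : R :=
  if j is j'.+1 then
    level_mass j' n.+1 (2 * k) (s + haar_jump n k) +
    level_mass j' n.+1 (2 * k).+1 (s + haar_jump n k)
  else if lam ^+ 2 < s then V n k else 0.

Fixpoint maximal_mass (j n k : nat) (m : R) : R :=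
  let m' := Num.max m (2 ^+ n * V n k) in
  if j is j'.+1 then
    maximal_mass j' n.+1 (2 * k) m' + maximal_mass j' n.+1 (2 * k).+1 m'
  else A n k * m'.

Hypothesis F_split : forall n k,
  F n k = F n.+1 (2 * k)%N + F n.+1 (2 * k).+1.
Hypothesis A_split : forall n k,
  A n k = A n.+1 (2 * k)%N + A n.+1 (2 * k).+1.
Hypothesis V_split : forall n k,
  V n k = V n.+1 (2 * k)%N + V n.+1 (2 * k).+1.
Hypothesis F_le_A : forall n k, `|F n k| <= A n k.
Hypothesis V_ge0 : forall n k, 0 <= V n k.
Hypothesis lam_gt0 : 0 < lam.

Lemma A_ge0 n k : 0 <= A n k.
Proof. exact: le_trans (F_le_A n k). Qed.

Lemma level_mass_le j n k s : level_mass j n k s <= V n k.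
Proof.
elim: j n k s => [|j IH] n k s /=; first by case: ifP.
by rewrite V_split lerD.
Qed.

(** Descending the tree only enlarges the running maximum, so it may be frozen at its value on the
    node; the masses [A] of the descendants then add up to [A n k]. *)
Lemma maximal_mass_ge j n k m :
  A n k * Num.max m (2 ^+ n * V n k) <= maximal_mass j n k m.
Proof.
elim: j n k m => [|j IH] n k m //=.
rewrite A_split mulrDl lerD // (le_trans _ (IH _ _ _)) // ler_wpM2l ?A_ge0 //.
  by rewrite le_max lexx.
by rewrite le_max lexx.
Qed.

Lemma maximal_mass_ge0 j n k m : 0 <= m -> 0 <= maximal_mass j n k m.
Proof.
move=> m0; apply: le_trans (maximal_mass_ge j n k m).
by rewrite mulr_ge0 ?A_ge0 // le_max m0.
Qed.

(** Controls the subtracted term of [level_mass_bound] wherever the induction ends: [F^2 <= A^2],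
    and one factor [2 ^ n * A] is traded for [2 * lam]. *)
Lemma stopped_node_bound n k m : 0 <= m -> 2 ^+ n * A n k <= 2 * lam ->
  Num.max m (2 ^+ n * V n k) * 2 ^+ n * F n k ^+ 2
    <= 2 * lam * (A n k * Num.max m (2 ^+ n * V n k)).
Proof.
move=> m0 A2; set M := Num.max _ _.
have M0 : 0 <= M by rewrite le_max m0.
have FA : F n k ^+ 2 <= A n k ^+ 2.
  by rewrite -(real_normK (num_real (F n k))) lerXn2r // ?nnegrE ?A_ge0.
have p0 : 0 <= 2 ^+ n :> R by rewrite exprn_ge0.
apply: (@le_trans _ _ (M * 2 ^+ n * A n k ^+ 2)).
  by rewrite ler_wpM2l // mulr_ge0.
have -> : M * 2 ^+ n * A n k ^+ 2 = (2 ^+ n * A n k) * (A n k * M) by ring.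
by rewrite ler_wpM2r // mulr_ge0 // A_ge0.
Qed.

(* The negative last term absorbs, by the parallelogram law
   [Fl^2 + Fr^2 = ((Fl + Fr)^2 + (Fr - Fl)^2) / 2], the increment that the Haar
   coefficient of the node adds to the running sum [s]. *)
Lemma level_mass_bound j n k s m : 0 <= s -> 0 <= m ->
  2 ^+ n * A n k <= 2 * lam ->
  lam ^+ 2 * level_mass j n k s <=
    3 * lam * maximal_mass j n k m + s * V n k
    - Num.max m (2 ^+ n * V n k) * 2 ^+ n * F n k ^+ 2.
Proof.
elim: j n k s m => [|j IH] n k s m s0 m0 A2.
- have := @stopped_node_bound n k m m0 A2 => /=.
  set M := Num.max _ _ => FB.
  have AM0 : 0 <= lam * (A n k * M).
    by rewrite !mulr_ge0 ?A_ge0 ?(ltW lam_gt0) // le_max m0.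
  (* Chebyshev's inequality on a leaf. The rest of the right side is at least
     [(3 - 2) * lam * (A n k * M)], hence nonnegative. *)
  suff : lam ^+ 2 * (if lam ^+ 2 < s then V n k else 0) <= s * V n k by lra.
  case: ifPn => [/ltW ls|_]; first by rewrite ler_wpM2r.
  by rewrite mulr0 mulr_ge0.
have [A1|A1] := lerP (2 ^+ n * A n k) lam; last first.
  (* Calderon-Zygmund stopping: the whole node is counted in the level set. *)
  have := @stopped_node_bound n k m m0 A2.
  have G := @maximal_mass_ge j.+1 n k m.
  have W := @level_mass_le j.+1 n k s.
  set g := maximal_mass j.+1 n k m in G *.
  set l := level_mass j.+1 n k s in W *.
  set M := Num.max _ _ in G * => FB.
  have VM : lam * V n k <= A n k * M.
    apply: (@le_trans _ _ ((2 ^+ n * A n k) * V n k)).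
      by rewrite ler_wpM2r // ltW.
    rewrite (mulrC (2 ^+ n)) -mulrA ler_wpM2l ?A_ge0 //.
    by rewrite le_max lexx orbT.
  have sV : 0 <= s * V n k by rewrite mulr_ge0.
  have : lam ^+ 2 * l <= lam * (A n k * M).
    apply: (@le_trans _ _ (lam ^+ 2 * V n k)).
      by rewrite ler_wpM2l // exprn_ge0 // ltW.
    by rewrite expr2 -mulrA ler_wpM2l // ltW.
  (* The constant is [3 = 1 + 2]: one copy of [lam * g] pays for the level set, two pay for the
     subtracted term. *)
  have : lam * (A n k * M) <= lam * g by rewrite ler_wpM2l // ltW.
  lra.
(* Passing to a child at most doubles the average of [|f|], so a node with average at most [lam]
   hands the invariant [2 * lam] to its children. *)
have A2l : 2 ^+ n.+1 * A n.+1 (2 * k) <= 2 * lam.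
  rewrite (exprS 2 n) -mulrA ler_wpM2l //; apply: le_trans A1.
  by rewrite ler_wpM2l ?exprn_ge0 // (A_split n k) lerDl A_ge0.
have A2r : 2 ^+ n.+1 * A n.+1 (2 * k).+1 <= 2 * lam.
  rewrite (exprS 2 n) -mulrA ler_wpM2l //; apply: le_trans A1.
  by rewrite ler_wpM2l ?exprn_ge0 // (A_split n k) lerDr A_ge0.
rewrite [level_mass _ _ _ _]/= [maximal_mass _ _ _ _]/=.
set M := Num.max _ _.
have M0 : 0 <= M by rewrite le_max m0.
have d0 : 0 <= haar_jump n k by rewrite sqr_ge0.
have := IH _ _ (s + haar_jump n k) M (addr_ge0 s0 d0) M0 A2l.
have := IH _ _ (s + haar_jump n k) M (addr_ge0 s0 d0) M0 A2r.
set gl := maximal_mass _ _ (2 * k)%N _; set gr := maximal_mass _ _ (2 * k).+1 _.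
set ll := level_mass _ _ (2 * k)%N _; set lr := level_mass _ _ (2 * k).+1 _.
set Ml := Num.max M (2 ^+ n.+1 * V n.+1 (2 * k)).
set Mr := Num.max M (2 ^+ n.+1 * V n.+1 (2 * k).+1).
have Mll : M <= Ml by rewrite le_max lexx.
have Mrr : M <= Mr by rewrite le_max lexx.
have hl : M * 2 ^+ n.+1 * F n.+1 (2 * k) ^+ 2
    <= Ml * 2 ^+ n.+1 * F n.+1 (2 * k) ^+ 2.
  by rewrite !ler_wpM2r // ?sqr_ge0 // exprn_ge0.
have hr : M * 2 ^+ n.+1 * F n.+1 (2 * k).+1 ^+ 2
    <= Mr * 2 ^+ n.+1 * F n.+1 (2 * k).+1 ^+ 2.
  by rewrite !ler_wpM2r // ?sqr_ge0 // exprn_ge0.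
(* The maximal average enters here: [M] dominates [2 ^ n * V n k], so the increment of [s * V n k]
   is at most the defect in the parallelogram law. *)
have dV : haar_jump n k * V n k
    <= M * 2 ^+ n * (F n.+1 (2 * k).+1 - F n.+1 (2 * k)) ^+ 2.
  rewrite /haar_jump exprMn.
  have -> : (2 ^+ n) ^+ 2 * (F n.+1 (2 * k).+1 - F n.+1 (2 * k)) ^+ 2 * V n k
    = (2 ^+ n * V n k) * 2 ^+ n * (F n.+1 (2 * k).+1 - F n.+1 (2 * k)) ^+ 2.
    by ring.
  rewrite !ler_wpM2r // ?sqr_ge0 ?exprn_ge0 //.
  by rewrite le_max lexx orbT.
have -> : M * 2 ^+ n * F n k ^+ 2 =
    M * 2 ^+ n.+1 * F n.+1 (2 * k) ^+ 2 + M * 2 ^+ n.+1 * F n.+1 (2 * k).+1 ^+ 2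
    - M * 2 ^+ n * (F n.+1 (2 * k).+1 - F n.+1 (2 * k)) ^+ 2.
  by rewrite (F_split n k) (exprS 2 n); ring.
have -> : s * V n k = s * V n.+1 (2 * k) + s * V n.+1 (2 * k).+1.
  by rewrite (V_split n k) mulrDr.
rewrite (V_split n k) in dV.
lra.
Qed.

Lemma root_level_mass_bound j :
  lam * level_mass j 0 0 0 <= 3 * maximal_mass j 0 0 0.
Proof.
rewrite -(ler_pM2l lam_gt0).
have [A2|A2] := lerP (2 ^+ 0 * A 0 0) (2 * lam).
  have := @level_mass_bound j 0 0 0 0 (lexx _) (lexx _) A2.
  rewrite mul0r addr0.
  have : 0 <= Num.max 0 (2 ^+ 0 * V 0 0) * 2 ^+ 0 * F 0 0 ^+ 2.
    by rewrite expr0 mulr1 mul1r mulr_ge0 ?sqr_ge0 // le_max lexx.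
  lra.
(* If the average over the root exceeds [2 * lam], the whole mass is already small:
   [2 * lam * V 0 0 <= A 0 0 * V 0 0 <= g]. *)
have := @maximal_mass_ge j 0 0 0; have := @level_mass_le j 0 0 0.
have := @maximal_mass_ge0 j 0 0 0 (lexx _).
set g := maximal_mass _ _ _ _; set l := level_mass _ _ _ _ => g0 lV.
rewrite expr0 !mul1r in A2 *.
have -> : Num.max 0 (V 0 0) = V 0 0 by apply/max_idPr.
move=> AV; rewrite ler_wpM2l ?(ltW lam_gt0) //.
have : lam * l <= lam * V 0 0 by rewrite ler_wpM2l // ltW.
have : 2 * lam * V 0 0 <= A 0 0 * V 0 0 by rewrite ler_wpM2r // ltW.
have : 0 <= lam * V 0 0 by rewrite mulr_ge0 // ltW.
lra.
Qed.

End tree.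

(** * Dyadic intervals and Haar coefficients *)

Section dyadic_intervals.
Context {R : realType}.
Local Notation mu := (@lebesgue_measure R).

Lemma dyadicP n k (x : R) :
  dyadic n k x <-> k%:R <= x * 2 ^+ n /\ x * 2 ^+ n < k%:R + 1.
Proof.
have p : 0 < 2 ^+ n :> R by rewrite exprn_gt0.
rewrite /dyadic /= in_itv /= ler_pdivrMr // ltr_pdivlMr // -[k.+1%:R]natr1.
by split => [/andP[]|[-> ->]].
Qed.

Lemma dyadic_split n k :
  dyadic n k = dyadic n.+1 (2 * k) `|` dyadic n.+1 (2 * k).+1 :> set R.
Proof.
apply/seteqP; split => x; rewrite /setU /= !dyadicP exprSr mulrA
  -[(2 * k).+1%:R]natr1 natrM.
  move=> [h1 h2]; have [h|h] := ltrP (x * 2 ^+ n * 2) (2 * k%:R + 1).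
    by left; split; lra.
  by right; split; lra.
by move=> [[h1 h2]|[h1 h2]]; split; lra.
Qed.

Lemma dyadic_inj n k k' (x : R) : dyadic n k x -> dyadic n k' x -> k = k'.
Proof.
rewrite !dyadicP !natr1 => -[h1 h2] [h3 h4].
have := le_lt_trans h1 h4; have := le_lt_trans h3 h2.
by rewrite !ltr_nat !ltnS => ? ?; apply/eqP; rewrite eqn_leq; apply/andP.
Qed.

Lemma dyadic_disj n k :
  [disjoint (dyadic n.+1 (2 * k) : set R) & dyadic n.+1 (2 * k).+1].
Proof.
apply/disj_setPS => x [/= h1 h2]; have /eqP := dyadic_inj h1 h2.
by rewrite eqn_leq ltnn andbF.
Qed.

Lemma dyadic00 : dyadic 0 0 = I0 :> set R.
Proof. by rewrite /dyadic /I0 expr0 !divr1. Qed.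

Lemma dyadic_sub n k : (k < 2 ^ n)%N -> dyadic n k `<=` (I0 : set R).
Proof.
move=> kn x /dyadicP[h1 h2].
have p : 0 < 2 ^+ n :> R by rewrite exprn_gt0.
rewrite /I0 /= in_itv /=; apply/andP; split.
  by rewrite -(pmulr_lge0 _ p) (le_trans _ h1).
rewrite -(ltr_pM2r p) mul1r (lt_le_trans h2) //.
by rewrite natr1 -natrX ler_nat.
Qed.

Lemma measurable_dyadic n k : measurable (dyadic n k : set (measurableTypeR R)).
Proof. exact: measurable_itv. Qed.

Lemma measurable_I0 : measurable (I0 : set (measurableTypeR R)).
Proof. exact: measurable_itv. Qed.

Lemma child_lt n k : (k < 2 ^ n)%N ->
  (2 * k < 2 ^ n.+1)%N /\ ((2 * k).+1 < 2 ^ n.+1)%N.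
Proof. by rewrite expnS; lia. Qed.

Lemma Rintegral_dyadic_split (f : R -> R) n k :
  mu.-integrable setT (EFin \o f) ->
  Rintegral mu (dyadic n k) f =
  Rintegral mu (dyadic n.+1 (2 * k)) f + Rintegral mu (dyadic n.+1 (2 * k).+1) f.
Proof.
move=> fi; rewrite dyadic_split Rintegral_setU //; first exact: measurable_dyadic.
- exact: measurable_dyadic.
- by apply: integrableS fi => //; apply: measurableU; exact: measurable_dyadic.
- exact: dyadic_disj.
Qed.

Definition haar_sq (f : R -> R) (n : nat) (x : R) : R :=
  \sum_(k < 2 ^ n) (haar_coef f n k ^+ 2 * \1_(dyadic n k) x / dyadic_length n).

Lemma haar_sq_dyadic f n k x : (k < 2 ^ n)%N -> dyadic n k x ->
  haar_sq f n x = haar_coef f n k ^+ 2 / dyadic_length n.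
Proof.
move=> kn xk; rewrite /haar_sq (bigD1 (Ordinal kn)) //= big1 ?addr0.
  by rewrite indicE mem_set // mulr1.
move=> i ik; rewrite indicE memNset ?mulr0 ?mul0r // => xi.
by case/eqP: ik; apply: val_inj => /=; exact: dyadic_inj xi xk.
Qed.

Lemma haar_sq_ge0 f n x : 0 <= haar_sq f n x.
Proof.
apply: sumr_ge0 => k _.
by rewrite mulr_ge0 ?(mulr_ge0 (sqr_ge0 _)) // !invr_ge0 exprn_ge0.
Qed.

Lemma measurable_haar_sq f n D : measurable_fun D (haar_sq f n).
Proof.
apply: measurable_sum => k; apply: measurable_funM => //.
by apply: measurable_funM => //; apply: measurable_indic; exact: measurable_dyadic.
Qed.

(** Links the analytic square function to the tree. The cut-off [f \_ I0] is integrable on the whole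
    line, so its integrals split additively on every [dyadic n k], also for [k >= 2 ^ n], as the
    tree hypotheses require. *)
Lemma haar_coef_sq (f : R -> R) n k : (k < 2 ^ n)%N ->
  mu.-integrable I0 (EFin \o f) ->
  haar_coef f n k ^+ 2 / dyadic_length n =
  haar_jump (fun n k => Rintegral mu (dyadic n k) (f \_ I0)) n k.
Proof.
move=> kn fi.
have [k1 k2] := child_lt kn.
have fT : mu.-integrable setT (EFin \o (f \_ I0)).
  by rewrite -restrict_EFin; apply: (integrable_mkcond _ measurable_I0).1.
have E i : (i < 2 ^ n.+1)%N ->
    mu.-integrable I0 (EFin \o (f \_ (dyadic n.+1 i))) /\
    Rintegral mu I0 (f \_ (dyadic n.+1 i)) =
    Rintegral mu (dyadic n.+1 i) (f \_ I0).
  move=> ni; split.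
    rewrite -restrict_EFin.
    apply: (integrable_restrict mu (measurable_dyadic _ _) measurable_I0 _).1.
    rewrite setIidr; last exact: dyadic_sub.
    by apply: integrableS fi;
      [exact: measurable_I0|exact: measurable_dyadic|exact: dyadic_sub].
  rewrite -Rintegral_mkcondr -[RHS]Rintegral_mkcondr; congr (Rintegral _ _ _).
  by rewrite setIC.
have -> : haar_coef f n k = (Num.sqrt (dyadic_length n))^-1 *
  (Rintegral mu (dyadic n.+1 (2 * k).+1) (f \_ I0)
   - Rintegral mu (dyadic n.+1 (2 * k)) (f \_ I0)).
  have [i1 <-] := E _ k1; have [i2 <-] := E _ k2.
  rewrite -RintegralB //; last exact: measurable_I0.
  rewrite -RintegralZl //; last 2 first.
  - exact: measurable_I0.
  - exact: (integrableB measurable_I0 i2 i1).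
  apply: eq_Rintegral => x _; rewrite /haar mulrCA; congr (_ * _).
  by rewrite mulrBr !indicE; do 2 case: (_ \in _); rewrite ?mulr1 ?mulr0.
have L0 : 0 < dyadic_length n :> R by rewrite invr_gt0 exprn_gt0.
rewrite /haar_jump !exprMn exprVn sqr_sqrtr ?(ltW L0) //.
by rewrite /dyadic_length invrK; ring.
Qed.

End dyadic_intervals.

(** * The weak-type inequality for the truncated square function *)

Section weak_type.
Context {R : realType}.
Local Notation mu := (@lebesgue_measure R).
Variables (f v : R -> R).
Hypothesis f_int : mu.-integrable I0 (EFin \o f).
Hypothesis v_int : mu.-integrable setT (EFin \o v).
Hypothesis v_ge0 : forall x, 0 <= v x.

Definition haar_sum (n j : nat) (x : R) : R := \sum_(n <= i < n + j) haar_sq f i x.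

(** The offset [s] stores the contribution of the levels above [n], which is constant on each dyadic
    interval of level [n]. *)
Definition superlevel (n j : nat) (s a : R) : set R :=
  [set x | a < s + haar_sum n j x].

Lemma measurable_superlevel n j s a :
  measurable (superlevel n j s a : set (measurableTypeR R)).
Proof.
have -> : superlevel n j s a = (fun x => s + haar_sum n j x) @^-1` `]a, +oo[.
  by apply/seteqP; split => x /=; rewrite in_itv /= andbT.
rewrite -[X in measurable X]setTI.
have m : measurable_fun setT (fun x : measurableTypeR R => s + haar_sum n j x).
  apply: measurable_funD => //; apply: measurable_sum => i.
  exact: measurable_haar_sq.
by apply: m => //; exact: measurable_itv.
Qed.

(** The term of level [n] is constant on [dyadic n k] and can be moved into the offset; this matches
    the recursion of [level_mass]. *)
Lemma superlevel_dyadic n j s a k : (k < 2 ^ n)%N ->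
  dyadic n k `&` superlevel n j.+1 s a =
  dyadic n k `&`
    superlevel n.+1 j (s + haar_coef f n k ^+ 2 / dyadic_length n) a.
Proof.
move=> kn.
have E x : dyadic n k x -> s + haar_sum n j.+1 x =
    s + haar_coef f n k ^+ 2 / dyadic_length n + haar_sum n.+1 j x.
  move=> xk; have nj : (n < n + j.+1)%N by lia.
  by rewrite /haar_sum (big_ltn nj) (haar_sq_dyadic _ kn xk) addrA addnS addSn.
by apply/seteqP; split => x [xk]; rewrite /superlevel /= E.
Qed.

Let F n k := Rintegral mu (dyadic n k) (f \_ I0).
Let A n k := Rintegral mu (dyadic n k) (fun x => `|(f \_ I0) x|).
Let V n k := Rintegral mu (dyadic n k) v.

Lemma fI0_int : mu.-integrable setT (EFin \o (f \_ I0)).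
Proof.
by rewrite -restrict_EFin; apply: (integrable_mkcond _ measurable_I0).1.
Qed.

Lemma level_mass_integral lam j n k s : (k < 2 ^ n)%N ->
  level_mass F V lam j n k s =
  Rintegral mu (dyadic n k `&` superlevel n j s (lam ^+ 2)) v.
Proof.
elim: j n k s => [|j IH] n k s kn.
  have -> : superlevel n 0 s (lam ^+ 2) = [set _ | lam ^+ 2 < s].
    by apply/seteqP; split => x;
      rewrite /superlevel /= /haar_sum addn0 big_geq // addr0.
  rewrite /=; case: ifP => h.
    by rewrite [X in _ `&` X](_ : _ = setT) ?setIT //; apply/seteqP; split.
  rewrite [X in _ `&` X](_ : _ = set0) ?setI0 ?Rintegral_set0 //.
  by apply/seteqP; split.
have [k1 k2] := child_lt kn.
rewrite /= !IH // superlevel_dyadic // haar_coef_sq // -/F.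
set S := superlevel _ _ _ _; rewrite (dyadic_split n k) setIUl Rintegral_setU //.
- by apply: measurableI; [exact: measurable_dyadic|exact: measurable_superlevel].
- by apply: measurableI; [exact: measurable_dyadic|exact: measurable_superlevel].
- apply: integrableS v_int => //; apply: measurableU; apply: measurableI;
    by [exact: measurable_dyadic|exact: measurable_superlevel].
- have /disj_setPS D := @dyadic_disj R n k.
  by apply/disj_setPS => x [[h1 _] [h2 _]]; exact: (D x).
Qed.

Lemma measurable_maximal_integrand (M : R -> \bar R) (m : R) D :
  measurable_fun (setT : set (measurableTypeR R)) M ->
  measurable_fun (D : set (measurableTypeR R))
    (fun x => `|(f \_ I0) x|%:E * maxe m%:E (M x))%E.
Proof.
move=> mM; apply: measurable_funTS.
apply: emeasurable_funM; last exact: measurable_maxe.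
apply/measurable_EFinP; apply: measurableT_comp => //.
by apply/measurable_EFinP; case/integrableP: fI0_int.
Qed.

(** Since [M] dominates every average of [v], absorbing the average of a node into the running
    maximum [m] leaves [maxe m M] unchanged on that node. Only the leaves lose something. *)
Lemma maximal_mass_integral (M : R -> \bar R) j n k (m : R) :
  measurable_fun (setT : set (measurableTypeR R)) M -> 0 <= m ->
  (forall i l x, (l < 2 ^ i)%N -> dyadic i l x ->
    ((2 ^+ i * V i l)%:E <= M x)%E) ->
  (k < 2 ^ n)%N ->
  ((maximal_mass A V j n k m)%:E <=
   \int[mu]_(x in dyadic n k) (`|(f \_ I0) x|%:E * maxe m%:E (M x)))%E.
Proof.
move=> mM + VM; elim: j n k m => [|j IH] n k m m0 kn.
  have mA : measurable_fun (dyadic n k : set (measurableTypeR R))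
      (fun x => `|(f \_ I0) x|%:E).
    apply/measurable_EFinP; apply: measurableT_comp => //.
    apply/measurable_EFinP; apply: measurable_funTS.
    by case/integrableP: fI0_int.
  have Ai : (A n k)%:E = (\int[mu]_(x in dyadic n k) (`|(f \_ I0) x|)%:E)%E.
    rewrite /A /Rintegral fineK //.
    apply: integrable_fin_num; first exact: measurable_dyadic.
    have /integrable_norm fi := fI0_int.
    by apply: integrableS fi => //; exact: measurable_dyadic.
  rewrite /= EFinM Ai muleC -ge0_integralZl //; last 2 first.
  - exact: measurable_dyadic.
  - by rewrite lee_fin le_max m0.
  apply: ge0_le_integral => //.
  - exact: measurable_dyadic.
  - by move=> x _; rewrite mule_ge0 ?lee_fin // le_max m0.
  - by apply: emeasurable_funM.
  - exact: measurable_maximal_integrand.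
  - move=> x xk; rewrite muleC lee_wpmul2l ?lee_fin //.
    rewrite EFin_max ge_max !le_max lexx /=.
    by rewrite VM ?orbT.
have [k1 k2] := child_lt kn.
have m'0 : 0 <= Num.max m (2 ^+ n * V n k) by rewrite le_max m0.
rewrite (dyadic_split n k) ge0_integral_setU //; last 5 first.
- exact: measurable_dyadic.
- exact: measurable_dyadic.
- exact: measurable_maximal_integrand.
- by move=> x _; rewrite mule_ge0 ?lee_fin // le_max lee_fin m0.
- exact: dyadic_disj.
rewrite /= EFinD leeD // (le_trans (IH _ _ _ m'0 _)) //.
  rewrite le_eqVlt; apply/orP; left; apply/eqP.
  apply: eq_integral => x; rewrite inE => xk; congr (_ * _)%E.
  rewrite EFin_max -maxA; congr (maxe _ _); apply/max_idPr; apply: VM => //.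
  by rewrite (dyadic_split n k); left.
rewrite le_eqVlt; apply/orP; left; apply/eqP.
apply: eq_integral => x; rewrite inE => xk; congr (_ * _)%E.
rewrite EFin_max -maxA; congr (maxe _ _); apply/max_idPr; apply: VM => //.
by rewrite (dyadic_split n k); right.
Qed.

(** The tree inequality at the root, read as integrals. Any majorant [M] of the averages is allowed,
    and the right side does not depend on the truncation level [j]. *)
Lemma weak_type_bound (M : R -> \bar R) j lam : 0 < lam ->
  measurable_fun (setT : set (measurableTypeR R)) M ->
  (forall x, (0 <= M x)%E) ->
  (forall i l x, (l < 2 ^ i)%N -> dyadic i l x ->
    ((2 ^+ i * V i l)%:E <= M x)%E) ->
  ((lam * Rintegral mu (I0 `&` superlevel 0 j 0 (lam ^+ 2)) v)%:E <=
   3%:E * \int[mu]_(x in I0) (`|f x|%:E * M x))%E.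
Proof.
move=> lam0 mM M0 VM.
rewrite -dyadic00 -level_mass_integral //.
have V0 n k : 0 <= V n k by apply: Rintegral_ge0.
have FA n k : `|F n k| <= A n k.
  apply: le_normr_Rintegral; first exact: measurable_dyadic.
  by apply: integrableS fI0_int => //; exact: measurable_dyadic.
have := @root_level_mass_bound R F A V lam _ _ _ FA V0 lam0 j.
rewrite -lee_fin => H; apply: (le_trans (H _ _ _)).
- by move=> n k; apply: Rintegral_dyadic_split fI0_int.
- move=> n k; apply: Rintegral_dyadic_split.
  exact: (integrable_norm fI0_int).
- by move=> n k; apply: Rintegral_dyadic_split v_int.
rewrite EFinM lee_wpmul2l //.
apply: (le_trans (maximal_mass_integral j mM (lexx _) VM _)) => //.
rewrite le_eqVlt; apply/orP; left; apply/eqP.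
apply: eq_integral => x; rewrite inE => xk; congr (_%:E * _)%E.
  by rewrite patchE mem_set // -dyadic00.
by apply/max_idPr.
Qed.

End weak_type.

(** * Superlevel sets of the square function *)

Section square_function_superlevel.
Context {R : realType}.
Local Notation mu := (@lebesgue_measure R).
Implicit Type f : R -> R.

Lemma haar_sum_homo f x :
  {homo (fun j => haar_sum f 0 j x) : j l / (j <= l)%N >-> j <= l}.
Proof.
move=> j l jl; rewrite /haar_sum !add0n [leRHS](big_cat_nat (n := j)) //= lerDl.
by apply: sumr_ge0 => i _; exact: haar_sq_ge0.
Qed.

(** The squared square function is the supremum of its increasing partial sums, and a supremum
    strictly exceeds [a ^ 2] exactly when some partial sum does. *)
Lemma square_fun_gt f (a : R) x : 0 < a ->
  (a%:E < `|square_fun f x|)%E <-> exists j, superlevel f 0 j 0 (a ^+ 2) x.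
Proof.
move=> a0; rewrite gee0_abs ?sqrte_ge0 // /square_fun.
set S := (X in sqrte X).
have S_haar_sq : S = (\sum_(0 <= n <oo) (haar_sq f n x)%:E)%E.
  by apply: eq_eseriesr => n _; rewrite sumEFin.
have S0 : (0 <= S)%E.
  by rewrite S_haar_sq; apply: nneseries_ge0 => n _ _; rewrite lee_fin haar_sq_ge0.
have SE : S = ereal_sup (range (fun j => (haar_sum f 0 j x)%:E)).
  rewrite S_haar_sq; apply/cvg_lim => //.
  rewrite (_ : (fun n => _) = fun j => (haar_sum f 0 j x)%:E).
    by apply: ereal_nondecreasing_cvgn => n m nm; rewrite lee_fin haar_sum_homo.
  by apply/funext => j; rewrite /haar_sum add0n sumEFin.
have -> : (a%:E < sqrte S)%E = ((a ^+ 2)%:E < S)%E.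
  rewrite -[a%:E]gee0_abs ?lee_fin ?(ltW a0) // -sqrte_sqr -EFin_expe.
  by rewrite !ltNge lee_sqrt // lee_fin sqr_ge0.
rewrite SE; split.
  by move/ereal_sup_gt => [_ [j _ <-]]; rewrite lte_fin => h; exists j;
    rewrite /superlevel /= add0r.
move=> [j]; rewrite /superlevel /= add0r -lte_fin => h.
by apply: (lt_le_trans h); apply: ereal_sup_ubound; exists j.
Qed.

Lemma square_fun_superlevel f (a : R) : 0 < a ->
  [set x | I0 x /\ (a%:E < `|square_fun f x|)%E] =
  \bigcup_j (I0 `&` superlevel f 0 j 0 (a ^+ 2)).
Proof.
move=> a0; apply/seteqP; split => x.
  by move=> [x0 /(square_fun_gt _ _ a0)[j xj]]; exists j.
by move=> [j _ [x0 xj]]; split => //; apply/(square_fun_gt _ _ a0); exists j.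
Qed.

Lemma measurable_square_fun_superlevel f (a : R) : 0 < a ->
  measurable ([set x | I0 x /\ (a%:E < `|square_fun f x|)%E]
    : set (measurableTypeR R)).
Proof.
move=> a0; rewrite square_fun_superlevel //; apply: bigcup_measurable => j _.
by apply: measurableI; [exact: measurable_I0|exact: measurable_superlevel].
Qed.

(** Continuity from below: the truncated superlevel sets increase to the full one, so a bound
    uniform in [j] survives the limit. *)
Lemma weight_measure_superlevel_le (w : R -> R) f (a : R) (B : \bar R) : 0 < a ->
  (forall x, 0 <= w x) ->
  measurable_fun (I0 : set (measurableTypeR R)) w ->
  (forall j, weight_measure w (I0 `&` superlevel f 0 j 0 (a ^+ 2)) <= B)%E ->
  (weight_measure w [set x | I0 x /\ (a%:E < `|square_fun f x|)%E] <= B)%E.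
Proof.
move=> a0 w0 mw wB; rewrite square_fun_superlevel // /weight_measure.
set F := fun j => I0 `&` superlevel f 0 j 0 (a ^+ 2).
have mF j : measurable (F j : set (measurableTypeR R)).
  by apply: measurableI; [exact: measurable_I0|exact: measurable_superlevel].
have FI j : F j `<=` I0 by move=> x [].
have ndF : {homo F : n m / (n <= m)%N >-> (n <= m)%O}.
  move=> n m nm; apply/subsetPset => x [x0 xn]; split => //.
  by rewrite /superlevel /= (lt_le_trans xn) // lerD2l haar_sum_homo.
have mEw j : measurable_fun (F j : set (measurableTypeR R)) (EFin \o w).
  by apply/measurable_EFinP; apply: measurable_funS (FI j) mw; exact: measurable_I0.
have w0F j x : F j x -> (0 <= (EFin \o w) x)%E by rewrite lee_fin.
have /cvg_lim <- // := ge0_nondecreasing_set_cvg_integral (mu := mu) ndF mF mEw w0F.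
apply: lime_le; last by near=> n; exact: wB.
apply: ereal_nondecreasing_is_cvgn.
by apply: ge0_nondecreasing_set_nondecreasing_integral => // j x _; rewrite lee_fin.
Unshelve. all: by end_near.
Qed.

End square_function_superlevel.

(** * Operator norms *)

Section maximal_function.
Context {R : realType}.
Local Notation mu := (@lebesgue_measure R).
Implicit Type f : R -> R.

(** The set where the supremum exceeds [a] is the countable union of the dyadic intervals whose
    average exceeds [a]. *)
Lemma measurable_dyadic_maximal f (D : set (measurableTypeR R)) :
  measurable_fun D (dyadic_maximal f).
Proof.
apply: measurable_funTS.
apply: (measurability _ (ErealGenOInfty.measurableE R)).
move=> /= _ [_ [a ->]] <-; rewrite setTI.
rewrite [X in measurable X](_ : _ = \bigcup_n \bigcup_k
    (if (k < 2 ^ n)%N && (a%:E < average (fun y => `|f y|%R) n k)%E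
     then dyadic n k else set0)).
  apply: bigcup_measurable => n _; apply: bigcup_measurable => k _.
  by case: ifP => // _; exact: measurable_dyadic.
apply/seteqP; split => x /=; rewrite in_itv /= andbT.
  move=> /ereal_sup_gt[_ [n [k [kn xk ->]]] h].
  by exists n => //; exists k => //; rewrite kn h.
move=> [n _ [k _]]; case: ifPn => // /andP[kn h] xk.
by apply: (lt_le_trans h); apply: ereal_sup_ubound; exists n, k.
Qed.

Lemma average_le_dyadic_maximal f n k (x : R) : (k < 2 ^ n)%N -> dyadic n k x ->
  (average (fun y => `|f y|%R) n k <= dyadic_maximal f x)%E.
Proof. by move=> kn xk; apply: ereal_sup_ubound; exists n, k. Qed.

(** For [x] in [I0] the average over [I0] itself competes in the supremum; outside [I0] the supremum
    is over the empty set and equals [-oo]. *)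
Lemma dyadic_maximal_ge0 f x : I0 x -> (0 <= dyadic_maximal f x)%E.
Proof.
rewrite -dyadic00 => x0; apply: le_trans (average_le_dyadic_maximal _ _ x0) => //.
rewrite mule_ge0 //; first by rewrite lee_fin invrK exprn_ge0.
by apply: integral_ge0 => y _; rewrite lee_fin.
Qed.

End maximal_function.

(** * From the weak-type inequality to a bound on superlevel sets *)

Section operator_bound.
Context {R : realType}.
Local Notation mu := (@lebesgue_measure R).

(** For finite [M] the difference of the two sides is a square divided by [2 * t * w]; for [M = +oo]
    the right side is [+oo]. *)
Lemma weighted_AMGM (t a w : R) (M : \bar R) : 0 < t -> 0 < w -> (0 <= M)%E ->
  (`|a|%:E * M <= (t / 2)%:E * (a%:E ^+ 2 * w%:E) +
                  (t^-1 / 2)%:E * (M ^+ 2 * w^-1%:E))%E.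
Proof.
move=> t0 w0; case: M => [m| |] //.
  rewrite lee_fin => m0; rewrite -!EFin_expe -!EFinM -EFinD lee_fin.
  rewrite -subr_ge0.
  have -> : t / 2 * (a ^+ 2 * w) + t^-1 / 2 * (m ^+ 2 / w) - `|a| * m
    = (t * `|a| * w - m) ^+ 2 / (2 * t * w).
    by rewrite -(real_normK (num_real a)); field; rewrite !gt_eqF.
  by rewrite divr_ge0 ?sqr_ge0 // !mulr_ge0 ?ltW.
move=> _; rewrite [(+oo ^+ 2)%E]expe2 mulyy gt0_mulye ?lte_fin ?invr_gt0 //.
rewrite [X in (_ <= _ + X)%E]gt0_muley ?lte_fin ?divr_gt0 ?invr_gt0 //.
by rewrite addey ?leey // -EFin_expe -EFinM.
Qed.

(** With [t = 3 * K ^ 2 / a] the [y] term on the right is half of the left side and is absorbed. For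
    [K = 0] this [t] is not positive, and small [t] force [y = 0] instead. *)
Lemma optimize_AMGM (a x y K : R) : 0 < a -> 0 <= x -> 0 <= y -> 0 <= K ->
  (forall t, 0 < t -> a * y <= 3 * (t / 2 * x + t^-1 / 2 * (K ^+ 2 * y))) ->
  a ^+ 2 * y <= 9 * K ^+ 2 * x.
Proof.
move=> a0 x0 y0; rewrite le_eqVlt => /orP[/eqP <-|K0] H; last first.
  have t0 : 0 < 3 * K ^+ 2 / a by rewrite divr_gt0 // mulr_gt0 // exprn_gt0.
  have := H _ t0; rewrite -(ler_pM2l a0).
  have -> : a * (3 * (3 * K ^+ 2 / a / 2 * x +
                      (3 * K ^+ 2 / a)^-1 / 2 * (K ^+ 2 * y)))
    = 9 * K ^+ 2 * x / 2 + a ^+ 2 * y / 2.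
    by field; rewrite !gt_eqF.
  lra.
rewrite expr0n /= mulr0 mul0r.
have [//|y1] := lerP (a ^+ 2 * y) 0.
have ay : 0 < a * y by move: y1; rewrite expr2 -mulrA pmulr_rgt0.
(* This [t] turns the right side into [a * y * (x / (2 * (x + 1)))], strictly below [a * y]; the
   [+ 1] covers [x = 0]. *)
have t0 : 0 < a * y / (3 * (x + 1)) by rewrite divr_gt0 // mulr_gt0 //; lra.
have := H _ t0; rewrite expr0n /= mul0r mulr0 addr0.
have -> : 3 * (a * y / (3 * (x + 1)) / 2 * x) = (a * y) * (x / (2 * (x + 1))).
  by field; apply/eqP; lra.
move=> h; suff : a * y * (x / (2 * (x + 1))) < a * y by lra.
rewrite gtr_pMr // ltr_pdivrMr; lra.
Qed.

Variables (w f : R -> R) (K : R).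
Local Notation winv := (fun x => (w x)^-1).
Hypothesis w_gt0 : forall x, 0 < w x.
Hypothesis w_int : mu.-integrable I0 (EFin \o w).
Hypothesis winv_int : mu.-integrable I0 (EFin \o winv).
Hypothesis K_ge0 : 0 <= K.
Hypothesis maximal_bound : forall g, L2 winv g ->
  (L2norm winv (dyadic_maximal g) <= K%:E * L2norm winv (EFin \o g))%E.
Hypothesis fL2 : L2 w f.

Let X : \bar R := (\int[mu]_(x in I0) ((f x)%:E ^+ 2 * (w x)%:E))%E.

Lemma measurable_weight : measurable_fun (I0 : set (measurableTypeR R)) w.
Proof. by apply/measurable_EFinP; case/integrableP: w_int. Qed.

Lemma measurable_invweight : measurable_fun (I0 : set (measurableTypeR R)) winv.
Proof. by apply/measurable_EFinP; case/integrableP: winv_int. Qed.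

Lemma measurable_L2_integrand : measurable_fun (I0 : set (measurableTypeR R))
  (fun x => (f x)%:E ^+ 2 * (w x)%:E)%E.
Proof.
under eq_fun do rewrite -EFin_expe -EFinM.
apply/measurable_EFinP; apply: measurable_funM; last exact: measurable_weight.
by apply: measurable_funX; case: fL2.
Qed.

Lemma L2_integrand_ge0 x : (0 <= (f x)%:E ^+ 2 * (w x)%:E)%E.
Proof. by rewrite -EFin_expe -EFinM lee_fin mulr_ge0 ?sqr_ge0 ?ltW. Qed.

Lemma L2_integral_ge0 : (0 <= X)%E.
Proof. by apply: integral_ge0 => x _; exact: L2_integrand_ge0. Qed.

Lemma L2_integral_fin : X \is a fin_num.
Proof.
rewrite -(sqrte_fin_num L2_integral_ge0) ge0_fin_numE ?sqrte_ge0 //.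
by case: fL2.
Qed.

(** AM-GM with [t = 1] and [M = 1] bounds [|f|] by [(f^2 w + w^-1) / 2], and both terms are
    integrable. *)
Lemma L2_integrable : mu.-integrable I0 (EFin \o f).
Proof.
have i1 : mu.-integrable I0 (fun x => (f x)%:E ^+ 2 * (w x)%:E)%E.
  apply/integrableP; split; first exact: measurable_L2_integrand.
  under eq_integral do rewrite gee0_abs ?L2_integrand_ge0 //.
  by rewrite -ge0_fin_numE ?L2_integral_ge0 ?L2_integral_fin.
have i2 : mu.-integrable I0 (EFin \o (fun x => f x ^+ 2 * w x + (w x)^-1)).
  exact: (integrableD measurable_I0 i1 winv_int).
apply: le_integrable i2.
- exact: measurable_I0.
- by apply/measurable_EFinP; case: fL2.
- move=> x _; rewrite !lee_fin.
  rewrite [leRHS]ger0_norm; last first.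
    by apply: addr_ge0; [exact: (mulr_ge0 (sqr_ge0 _) (ltW _))|
      rewrite invr_ge0 ltW].
  have := @weighted_AMGM 1 (f x) (w x) 1%:E ltr01 (w_gt0 x) (@lee01 R).
  rewrite -!EFin_expe -!EFinM -EFinD lee_fin.
  have : 0 <= f x ^+ 2 * w x by rewrite mulr_ge0 ?sqr_ge0 ?ltW.
  have : 0 <= (w x)^-1 by rewrite invr_ge0 ltW.
  by rewrite invr1 expr1n; lra.
Qed.

Lemma superlevel_measure_bound (a : R) j : 0 < a ->
  ((a ^+ 2)%:E * weight_measure w (I0 `&` superlevel f 0 j 0 (a ^+ 2))
   <= (9 * K ^+ 2)%:E * X)%E.
Proof.
move=> a0.
set E := I0 `&` _.
have mE : measurable (E : set (measurableTypeR R)).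
  by apply: measurableI; [exact: measurable_I0|exact: measurable_superlevel].
have EI : E `<=` I0 by move=> x [].
have wE_int : mu.-integrable E (EFin \o w).
  by apply: integrableS w_int => //; exact: measurable_I0.
(* [w(E)] is finite because [w] is integrable; this is what allows [y] to be absorbed in
   [optimize_AMGM]. *)
set y := Rintegral mu E w.
have yE : weight_measure w E = y%:E.
  by rewrite /y /Rintegral fineK //; exact: integrable_fin_num.
have y0 : 0 <= y by apply: Rintegral_ge0 => x _; exact: ltW.
pose v : R -> R := w \_ E.
have v0 x : 0 <= v x by rewrite /v patchE; case: ifP => // _; exact: ltW.
have v_int : mu.-integrable setT (EFin \o v).
  by rewrite -restrict_EFin; apply: (integrable_mkcond _ mE).1.
have mv : measurable_fun setT (EFin \o v) by case/integrableP: v_int.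
have vE : (\int[mu]_(x in I0) ((v x)%:E ^+ 2 * (winv x)%:E))%E = y%:E.
  transitivity (\int[mu]_(x in I0) ((EFin \o w) \_ E) x)%E.
    apply: eq_integral => x _; rewrite /v !patchE; case: ifP => _.
      rewrite -EFin_expe -EFinM /= expr2 mulfK // gt_eqF //.
    by rewrite -EFin_expe -EFinM expr0n mul0r.
  by rewrite -integral_mkcondr setIidr.
have vL2 : L2 winv v.
  split; first by apply/measurable_EFinP; exact: measurable_funTS.
  by rewrite /L2norm /= vE; rewrite -ge0_fin_numE ?sqrte_ge0 // sqrte_fin_num.
pose M := dyadic_maximal v.
set Z := (\int[mu]_(x in I0) (M x ^+ 2 * (winv x)%:E))%E.
have ZK : (Z <= (K ^+ 2 * y)%:E)%E.
  have := maximal_bound vL2; rewrite /L2norm /= vE -/M -/Z.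
  have -> : K%:E = sqrte (K ^+ 2)%:E by rewrite EFin_expe sqrte_sqr gee0_abs.
  by rewrite -sqrteM ?lee_fin ?sqr_ge0 // lee_sqrt // lee_fin mulr_ge0 ?sqr_ge0.
(* [M] is [-oo] outside [I0], while [weak_type_bound] asks for a majorant nonnegative on the whole
   line; on [I0] nothing changes. *)
pose M' (x : R) : \bar R := maxe 0%E (M x).
have M'E x : I0 x -> M' x = M x.
  by move=> x0; apply/max_idPr; exact: dyadic_maximal_ge0.
have mM : measurable_fun setT M by exact: measurable_dyadic_maximal.
have yv : Rintegral mu (I0 `&` superlevel f 0 j 0 (a ^+ 2)) v = y.
  by rewrite /y /v -Rintegral_mkcondr setIid.
have W : ((a * y)%:E <= 3%:E * \int[mu]_(x in I0) (`|f x|%:E * M' x))%E.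
  rewrite -yv; apply: weak_type_bound => //; first exact: L2_integrable.
  - exact: measurable_maxe.
  - by move=> x; rewrite le_max lexx.
  move=> i l x il xl; rewrite le_max; apply/orP; right.
  apply: le_trans (average_le_dyadic_maximal _ il xl).
  rewrite /average /dyadic_length invrK EFinM lee_wpmul2l ?lee_fin ?exprn_ge0 //.
  rewrite /Rintegral fineK; last first.
    apply: integrable_fin_num; first exact: measurable_dyadic.
    by apply: integrableS v_int => //; exact: measurable_dyadic.
  rewrite le_eqVlt; apply/orP; left; apply/eqP.
  by apply: eq_integral => z _; rewrite ger0_norm.
have mM2 : measurable_fun (I0 : set (measurableTypeR R))
    (fun x => M x ^+ 2 * (winv x)%:E)%E.
  under eq_fun do rewrite expe2.
  apply: emeasurable_funM; first by apply: emeasurable_funM; exact: measurable_funTS.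
  by apply/measurable_EFinP; exact: measurable_invweight.
have M2_ge0 x : (0 <= M x ^+ 2 * (winv x)%:E)%E.
  by rewrite mule_ge0 ?sqre_ge0 // lee_fin invr_ge0 ltW.
have bound t : 0 < t -> a * y <= 3 * (t / 2 * fine X + t^-1 / 2 * (K ^+ 2 * y)).
  move=> t0; rewrite -lee_fin; apply: (le_trans W); rewrite EFinM lee_wpmul2l //.
  rewrite EFinD (EFinM (t / 2)) (EFinM (t^-1 / 2)) fineK ?L2_integral_fin //.
  have t20 : 0 <= t / 2 by rewrite divr_ge0 // ltW.
  have ti0 : 0 <= t^-1 / 2 by rewrite divr_ge0 // invr_ge0 ltW.
  apply: (@le_trans _ _ (\int[mu]_(x in I0) (
      (t / 2)%:E * ((f x)%:E ^+ 2 * (w x)%:E)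
      + (t^-1 / 2)%:E * (M x ^+ 2 * (winv x)%:E)))%E).
    apply: ge0_le_integral.
    - exact: measurable_I0.
    - by move=> x x0; rewrite mule_ge0 ?lee_fin // le_max lexx.
    - apply: emeasurable_funM; last by apply: measurable_funTS; exact: measurable_maxe.
      by apply/measurable_EFinP; apply: measurableT_comp => //; case: fL2.
    - apply: emeasurable_funD; apply: emeasurable_funM => //.
      exact: measurable_L2_integrand.
    - move=> x x0; rewrite M'E //; apply: weighted_AMGM => //.
      exact: dyadic_maximal_ge0.
  rewrite ge0_integralD; last 5 first.
  - exact: measurable_I0.
  - by move=> x _; apply: mule_ge0; [rewrite lee_fin|exact: L2_integrand_ge0].
  - by apply: emeasurable_funM => //; exact: measurable_L2_integrand.
  - by move=> x _; apply: mule_ge0; rewrite ?lee_fin.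
  - by apply: emeasurable_funM.
  rewrite (ge0_integralZl mu measurable_I0 measurable_L2_integrand) ?lee_fin //;
    last by move=> x _; exact: L2_integrand_ge0.
  rewrite (ge0_integralZl mu measurable_I0 mM2) ?lee_fin //.
  by rewrite leeD // lee_wpmul2l // lee_fin.
rewrite yE -(fineK L2_integral_fin) -!EFinM lee_fin.
by apply: optimize_AMGM bound => //; rewrite fine_ge0 ?L2_integral_ge0.
Qed.

End operator_bound.

(** * Comparison of the operator norms, and exceptional null sets *)

Section operator_norms.
Context {R : realType}.
Local Notation mu := (@lebesgue_measure R).
Local Notation mfunI0 f := (measurable_fun (I0 : set (measurableTypeR R)) f).

Lemma ae_imp (P Q : R -> Prop) : (forall x, P x -> Q x) ->
  {ae mu, forall x, P x} -> {ae mu, forall x, Q x}.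
Proof. by move=> PQ; apply: (@filterS _ _ (ae_filter_ringOfSetsType mu)). Qed.

(** Each constant [K] admissible for the maximal operator makes [3 * K] admissible for the square
    function. If there is no such [K], the right side is [+oo]. *)
Lemma opnorm_positive_weight (w : R -> R) (winv := fun x => (w x)^-1) :
  (forall x, 0 < w x) ->
  mu.-integrable I0 (EFin \o w) -> mu.-integrable I0 (EFin \o winv) ->
  (opnorm w (weakL2norm w) square_fun
    <= 3%:E * opnorm winv (L2norm winv) dyadic_maximal)%E.
Proof.
move=> w0 wi wvi; rewrite -lee_pdivrMl //.
apply: le_ereal_inf_tmp => _ [K [K0 HK] <-].
rewrite lee_pdivrMl //; apply: ereal_inf_lbound; exists (3 * K) => //.
split => [|f fL2]; first by rewrite mulr_ge0.
apply: ge_ereal_sup => y [a /=]; rewrite in_itv /= andbT => a0 <- {y}.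
set X := (\int[mu]_(x in I0) ((f x)%:E ^+ 2 * (w x)%:E))%E.
have X0 : (0 <= X)%E by exact: L2_integral_ge0.
have c0 : 0 <= 9 * K ^+ 2 by rewrite mulr_ge0 ?sqr_ge0.
have a20 : 0 < a ^+ 2 by rewrite exprn_gt0.
set W := weight_measure _ _.
have WB : (W <= ((a ^+ 2)^-1)%:E * ((9 * K ^+ 2)%:E * X))%E.
  apply: weight_measure_superlevel_le => //; first by move=> x; exact: ltW.
    exact: measurable_weight.
  by move=> j; rewrite lee_pdivlMl //; exact: superlevel_measure_bound.
rewrite lee_pdivlMl // in WB.
(* All factors become square roots, so that the claim reduces to [WB] under a single [sqrte]. *)
have -> : a%:E = sqrte (a ^+ 2)%:E.
  by rewrite EFin_expe sqrte_sqr gee0_abs ?lee_fin ?ltW.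
have -> : (3 * K)%:E = sqrte (9 * K ^+ 2)%:E.
  have -> : 9 * K ^+ 2 = (3 * K) ^+ 2 by ring.
  by rewrite EFin_expe sqrte_sqr gee0_abs // lee_fin mulr_ge0.
rewrite -[L2norm w _]/(sqrte X) -!sqrteM ?lee_fin ?(ltW a20) //.
by rewrite lee_sqrt // mule_ge0.
Qed.

Lemma L2norm_ae (u u' : R -> R) (g : R -> \bar R) :
  mfunI0 u -> mfunI0 u' -> mfunI0 g ->
  {ae mu, forall x, I0 x -> u x = u' x} -> L2norm u g = L2norm u' g.
Proof.
move=> mu_ mu' mg uu'; congr sqrte.
apply: ae_eq_integral; first exact: measurable_I0.
- under eq_fun do rewrite expe2.
  by apply: emeasurable_funM; [exact: emeasurable_funM|exact/measurable_EFinP].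
- under eq_fun do rewrite expe2.
  by apply: emeasurable_funM; [exact: emeasurable_funM|exact/measurable_EFinP].
- by apply: ae_imp uu' => x uu' x0; rewrite uu'.
Qed.

(** Almost everywhere [(u g)^2 u' = u g^2], so multiplication by [u] is an isometry from [L^2(u)] to
    [L^2(u')]. *)
Lemma L2norm_mul (u u' g : R -> R) :
  mfunI0 u -> mfunI0 u' -> mfunI0 g ->
  {ae mu, forall x, I0 x -> u x * u' x = 1} ->
  L2norm u' (EFin \o (fun x => u x * g x)) = L2norm u (EFin \o g).
Proof.
move=> mu_ mu' mg uu'; congr sqrte.
apply: ae_eq_integral; first exact: measurable_I0.
- under eq_fun do rewrite -EFin_expe -EFinM.
  apply/measurable_EFinP; apply: measurable_funM => //.
  by apply: measurable_funX; exact: measurable_funM.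
- under eq_fun do rewrite -EFin_expe -EFinM.
  by apply/measurable_EFinP; apply: measurable_funM => //; exact: measurable_funX.
- apply: ae_imp uu' => x uu' x0; rewrite /comp -!EFin_expe -!EFinM; congr EFin.
  by rewrite exprMn [u x ^+ 2]expr2 -[RHS]mulr1 -(uu' x0); ring.
Qed.

Lemma weight_measure_ae (u u' : R -> R) (A : set (measurableTypeR R)) :
  measurable A -> A `<=` I0 -> mfunI0 u -> mfunI0 u' ->
  {ae mu, forall x, I0 x -> u x = u' x} ->
  weight_measure u A = weight_measure u' A.
Proof.
move=> mA AI mu_ mu' uu'; apply: ae_eq_integral => //.
- by apply/measurable_EFinP; apply: measurable_funS AI mu_; exact: measurable_I0.
- by apply/measurable_EFinP; apply: measurable_funS AI mu'; exact: measurable_I0.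
- by apply: ae_imp uu' => x uu' xA; rewrite uu' //; exact: AI.
Qed.

(** The square function sees its argument only through Haar coefficients, which are integrals; hence
    equality at every point. *)
Lemma square_fun_ae (f g : R -> R) : mfunI0 f -> mfunI0 g ->
  {ae mu, forall x, I0 x -> f x = g x} -> square_fun f = square_fun g.
Proof.
move=> mf mg fg.
have E n k : haar_coef f n k = haar_coef g n k.
  have mh : mfunI0 (@haar R n k).
    by apply: measurable_funM => //; apply: measurable_funB;
      apply: measurable_indic; exact: measurable_dyadic.
  congr fine; apply: ae_eq_integral; first exact: measurable_I0.
  - by apply/measurable_EFinP; exact: measurable_funM.
  - by apply/measurable_EFinP; exact: measurable_funM.
  - by apply: ae_imp fg => x fg x0; rewrite fg.
apply/funext => x; congr sqrte; apply: eq_eseriesr => n _.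
by apply: eq_bigr => k _; rewrite E.
Qed.

Lemma opnorm_eq (u u' : R -> R) (N N' : (R -> \bar R) -> \bar R)
    (T : (R -> R) -> R -> \bar R) :
  (forall f, mfunI0 f -> L2norm u (EFin \o f) = L2norm u' (EFin \o f)) ->
  (forall f, mfunI0 f -> N (T f) = N' (T f)) ->
  opnorm u N T = opnorm u' N' T.
Proof.
move=> L NT; congr ereal_inf; apply/seteqP; split => _ [K [K0 H] <-];
  exists K => //; split => // f [mf fL].
  by rewrite -NT // -L //; apply: H; split => //; rewrite L.
by rewrite NT // L //; apply: H; split => //; rewrite -L.
Qed.

Lemma opnorm_square_fun_weight (u u' : R -> R) (N : (R -> \bar R) -> \bar R) :
  mfunI0 u -> mfunI0 u' ->
  {ae mu, forall x, I0 x -> u x * u' x = 1} ->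
  opnorm u' N (square_fun_weight u') = opnorm u N square_fun.
Proof.
move=> mu_ mu' uu'.
have u'u : {ae mu, forall x, I0 x -> u' x * u x = 1}.
  by apply: ae_imp uu' => x h x0; rewrite mulrC h.
congr ereal_inf; apply/seteqP; split => _ [K [K0 H] <-];
  exists K => //; split => // f [mf fL].
  (* The hypothesis is tested on [u * f] here, and on [u' * f] in the converse direction, where the
     two square functions agree by definition. *)
  have -> : square_fun f = square_fun_weight u' (fun x => u x * f x).
    apply: square_fun_ae => //.
      by apply: measurable_funM => //; exact: measurable_funM.
    by apply: ae_imp u'u => x h x0; rewrite mulrA h // mul1r.
  rewrite -(L2norm_mul mu_ mu' mf uu'); apply: H; split; first exact: measurable_funM.
  by rewrite (L2norm_mul mu_ mu' mf uu').
rewrite -(L2norm_mul mu' mu_ mf u'u); apply: H; split; first exact: measurable_funM.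
by rewrite (L2norm_mul mu' mu_ mf u'u).
Qed.

(** Superlevel sets of a square function are measurable, so densities equal almost everywhere give
    them the same mass. *)
Lemma weakL2norm_square_fun_ae (u u' f : R -> R) : mfunI0 u -> mfunI0 u' ->
  {ae mu, forall x, I0 x -> u x = u' x} ->
  weakL2norm u (square_fun f) = weakL2norm u' (square_fun f).
Proof.
move=> mu_ mu' uu'; congr ereal_sup; apply: eq_imagel => a /=.
rewrite in_itv /= andbT => a0; congr (_ * sqrte _)%E.
apply: weight_measure_ae => //; first exact: measurable_square_fun_superlevel.
by move=> x [].
Qed.

Lemma integrable_ae (u u' : R -> R) : mfunI0 u' ->
  mu.-integrable I0 (EFin \o u) -> {ae mu, forall x, I0 x -> u x = u' x} ->
  mu.-integrable I0 (EFin \o u').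
Proof.
move=> mu' /integrableP[mu_ ui] uu'; apply/integrableP.
split; first exact/measurable_EFinP.
suff <- : (\int[mu]_(x in I0) `|(EFin \o u) x| =
           \int[mu]_(x in I0) `|(EFin \o u') x|)%E by [].
apply: ae_eq_integral.
- exact: measurable_I0.
- exact: measurableT_comp.
- by apply: measurableT_comp => //; exact/measurable_EFinP.
- by apply: ae_imp uu' => x h x0 /=; rewrite h.
Qed.

Lemma opnorm_square_fun_le (w : R -> R) (winv := fun x => (w x)^-1) : weight w ->
  (opnorm w (weakL2norm w) square_fun
    <= 3%:E * opnorm winv (L2norm winv) dyadic_maximal)%E.
Proof.
move=> [w0 wi wvi].
have mw := measurable_weight wi; have mwv := measurable_weight wvi.
(* [w] may take junk values on a null set, where it is replaced by [1]. *)
pose w' x := if 0 < w x then w x else 1.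
have mif (u : R -> R) : mfunI0 u -> mfunI0 (fun x => if 0 < w x then u x else 1).
  move=> m; apply: measurable_fun_if => //; first exact: measurable_I0.
  - exact: measurable_fun_ltr.
  - by apply: measurable_funS m => //; exact: measurable_I0.
have w'gt0 x : 0 < w' x by rewrite /w'; case: ifP.
have ww' : {ae mu, forall x, I0 x -> w x = w' x}.
  by apply: ae_imp w0 => x h x0; rewrite /w' h.
have wwv' : {ae mu, forall x, I0 x -> winv x = (w' x)^-1}.
  by apply: ae_imp ww' => x h x0; rewrite /winv h.
have mw' : mfunI0 w' by exact: mif.
have mwv' : mfunI0 (fun x => (w' x)^-1).
  rewrite (_ : (fun x => _) = fun x => if 0 < w x then winv x else 1).
    exact: mif.
  by apply/funext => x; rewrite /w'; case: ifP => _ //; rewrite invr1.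
have -> : opnorm w (weakL2norm w) square_fun =
    opnorm w' (weakL2norm w') square_fun.
  apply: opnorm_eq => f mf.
    by apply: L2norm_ae => //; exact/measurable_EFinP.
  exact: weakL2norm_square_fun_ae.
have -> : opnorm winv (L2norm winv) dyadic_maximal =
    opnorm (fun x => (w' x)^-1) (L2norm (fun x => (w' x)^-1)) dyadic_maximal.
  apply: opnorm_eq => f mf; apply: L2norm_ae => //; first exact/measurable_EFinP.
  exact: measurable_dyadic_maximal.
apply: opnorm_positive_weight => //.
  exact: integrable_ae ww'.
exact: integrable_ae wwv'.
Qed.

End operator_norms.

Theorem theorem4p6 (R : realType) :
  exists C : R, 0 < C /\
    forall w : R -> R, weight w ->
      let winv := fun x => (w x)^-1 in
      opnorm winv (weakL2norm w) (square_fun_weight winv)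
        = opnorm w (weakL2norm w) square_fun /\
      (opnorm w (weakL2norm w) square_fun
        <= C%:E * opnorm winv (L2norm winv) dyadic_maximal)%E.
Proof.
exists 3; split => // w ww winv; split; last exact: opnorm_square_fun_le.
case: ww => w0 /measurable_weight mw /measurable_weight mwv.
apply: opnorm_square_fun_weight => //.
by apply: ae_imp w0 => x h x0; rewrite mulfV // gt_eqF // h.
Qed.
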